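(* Let $A$ be an octonion division algebra over a field $F$, let $\phi(z)=z^n+c_{n-1}z^{n-1}+\dots+c_1z+c_0$ be a monic standard polynomial over $A$, $n\ge1$, with companion polynomial $\Phi(z)$ and companion matrix $C_\phi$, and let $E(N,T)=\sum_{i=0}^n c_ie_i(N,T)$ and $G(N,T)=\sum_{i=0}^n c_ig_i(N,T)$ (with $c_n=1$), where $e_i,g_i$ are the polynomials defined in the context. Then: 1. $R(\phi)\subseteq LEV(C_\phi)\subseteq R(\Phi)$. 2. For every conjugacy class $[z_0]\subseteq R(\Phi)$, of norm $N_0$ and trace $T_0$: if $E(N_0,T_0)=0$ then $[z_0]\subseteq LEV(C_\phi)$; otherwise $$[z_0]\cap LEV(C_\phi)=\{-(E(N_0,T_0)^{-1}\gamma)(\gamma^{-1}G(N_0,T_0)):\gamma\in A^\times\}.$$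
   Context: $F$ is a field of arbitrary characteristic. An octonion algebra over $F$ is an algebra $A=Q\oplus Q\ell$, where $Q$ is a quaternion algebra over $F$ with its canonical symplectic involution $\bar{\ }$, $\ell^2\in F^\times$, and multiplication is $(p+q\ell)(r+s\ell)=pr+\ell^2\bar{s}q+(sp+q\bar{r})\ell$. The involution extends to $A$ by $\overline{p+q\ell}=\overline{p}-q\ell$. The norm form $\operatorname{Norm}(x)=\overline{x}\cdot x$ and the trace form $\operatorname{Tr}(x)=x+\overline{x}$ take values in $F$. $A$ is alternative; it is a division algebra if and only if its norm form is anisotropic. Every $z\in A$ with $\operatorname{Tr}(z)=T$, $\operatorname{Norm}(z)=N$ satisfies $z^2-Tz+N=0$. Two elements $g,g'\in A$ are conjugate if there is $h\in A^\times$ with $hgh^{-1}=g'$; equivalently, $\operatorname{Tr}(g)=\operatorname{Tr}(g')$ and $\operatorname{Norm}(g)=\operatorname{Norm}(g')$. The conjugacy class of $z_0$ is $[z_0]$; its norm and trace are those of $z_0$. A standard polynomial over $A$ has its coefficients in $A$ on the left of the variable; for $\lambda\in A$, $\phi(\lambda)=c_n\lambda^n+\dots+c_1\lambda+c_0$, and $R(\phi)=\{\lambda\in A:\phi(\lambda)=0\}$. The companion polynomial of $\phi$ is $\Phi(z)=b_{2n}z^{2n}+\dots+b_1z+b_0$ where, for $k\in\{0,\dots,2n\}$: if $k$ is odd, $b_k$ is the sum of all $\operatorname{Tr}(\overline{c_i}c_j)$ with $0\le i<j\le n$ and $i+j=k$; if $k=2m$ is even, $b_k$ is the sum of all $\operatorname{Tr}(\overline{c_i}c_j)$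 with $0\le i<j\le n$ and $i+j=k$, plus $\operatorname{Norm}(c_m)$ (here $c_n=1$). The $b_k$ lie in $F$; $R(\Phi)$ is the set of roots of $\Phi$ in $A$, which is a union of conjugacy classes. The polynomials $e_i(N,T),g_i(N,T)$ in the central variables $N,T$ are those obtained by repeatedly substituting $z^2=Tz-N$, so that $z^i=e_i(N,T)z+g_i(N,T)$ for all $z\in A$ of norm $N$ and trace $T$; explicitly $e_0=0$, $g_0=1$, $e_{i+1}=Te_i+g_i$, $g_{i+1}=-Ne_i$. Thus $\phi(z)=E(N,T)z+G(N,T)$ for $z$ of norm $N$ and trace $T$. The companion matrix $C_\phi$ is the $n\times n$ matrix over $A$ with $1$'s in positions $(i,i+1)$ for $1\le i\le n-1$, last row $(-c_0,-c_1,\dots,-c_{n-1})$, and zeros elsewhere. A left eigenvalue of $C_\phi$ is an element $\lambda\in A$ such that $C_\phi v=\lambda v$ for some nonzero column vector $v\in A^n$; $LEV(C_\phi)$ is the set of left eigenvalues. *)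

(* Defs.v *)
From HB Require Import structures.
From mathcomp Require Import all_boot all_order all_algebra all_field.

Set Implicit Arguments.
Unset Strict Implicit.
Unset Printing Implicit Defensive.

Import GRing.Theory.
Local Open Scope ring_scope.

(** * Quaternion algebras (any characteristic) *)

(* A quaternion algebra is a central simple algebra of dimension 4; an ideal
   is in particular a linear subspace, as the algebra is unital. *)
Definition is_quaternion_algebra (F : fieldType) (Q : falgType F) : Prop :=
  [/\ \dim {: Q} = 4%N,
      'Z({: Q})%VS = 1%VS
    & forall I : {vspace Q},
        ({: Q} * I <= I)%VS -> (I * {: Q} <= I)%VS ->
        I = 0%VS \/ I = {: Q}%VS].

(* On a quaternion algebra, the canonical symplectic involution x |-> Trd x - x
   is the only involution for which x + bar x and bar x * x are scalars.
   Here 1%VS is the line F 1. *)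
Definition is_canonical_involution (F : fieldType) (Q : falgType F)
    (bar : {linear Q -> Q}) : Prop :=
  [/\ involutive bar,
      forall x y, bar (x * y) = bar y * bar x,
      forall x, x + bar x \in 1%VS
    & forall x, bar x * x \in 1%VS].

(** * Octonion algebras *)

Record octonionAlgebra (F : fieldType) := OctonionAlgebra {
  oct_quat : falgType F;
  oct_bar : {linear oct_quat -> oct_quat};
  oct_ell2 : F;
  oct_quatP : is_quaternion_algebra oct_quat;
  oct_barP : is_canonical_involution oct_bar;
  oct_ell2_neq0 : oct_ell2 != 0
}.

(* The carrier: the pair (p, q) stands for p + q ell.  It only gets the vector
   space structure of the product, not its componentwise multiplication. *)
Definition octonion (F : fieldType) (A : octonionAlgebra F) : Type :=
  (oct_quat A * oct_quat A)%type.

HB.instance Definition _ (F : fieldType) (A : octonionAlgebra F) :=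
  Vector.copy (octonion A) (oct_quat A * oct_quat A)%type.

Coercion octonion : octonionAlgebra >-> Sortclass.

Section Octonions.
Variables (F : fieldType) (A : octonionAlgebra F).
Implicit Types x y z : A.

Definition oct1 : A := (1, 0).

Definition omul x y : A :=
  let: (p, q) := x in let: (r, s) := y in
  (p * r + oct_ell2 A *: (oct_bar A s * q), s * p + q * oct_bar A r).

Definition oconj x : A := (oct_bar A x.1, - x.2).

(* The coefficient k of an element of A of the form k *: oct1. *)
Definition oscal x : F := coord [tuple (1 : oct_quat A)] ord0 x.1.

Definition otr x : F := oscal (x + oconj x).
Definition onorm x : F := oscal (omul (oconj x) x).

Lemma oscalK (k : F) : oscal (k *: oct1) = k.
Proof.
rewrite /oscal /= linearZ /= (coord_free (X := [tuple _]) ord0 ord0).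
  by rewrite mulr1.
by rewrite seq1_free oner_eq0.
Qed.

Lemma otrE x : otr x *: oct1 = x + oconj x.
Proof.
suff [k Dk]: exists k, x + oconj x = k *: oct1 by rewrite /otr Dk oscalK.
case: (oct_barP A) => _ _ trP _; case: x => p q.
by have /vlineP[k Dk] := trP p; exists k; congr (_, _); rewrite //= subrr scaler0.
Qed.

Lemma onormE x : onorm x *: oct1 = omul (oconj x) x.
Proof.
suff [k Dk]: exists k, omul (oconj x) x = k *: oct1 by rewrite /onorm Dk oscalK.
case: (oct_barP A) => _ _ _ normP; case: x => p q.
have /vlineP[k1 Dk1] := normP p; have /vlineP[k2 Dk2] := normP q.
exists (k1 - oct_ell2 A * k2); congr (_, _) => /=.
  by rewrite mulrN Dk1 Dk2 scalerN scalerA -scalerBl.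
by rewrite mulNr subrr scaler0.
Qed.

Fixpoint oexp x (i : nat) : A := if i is j.+1 then omul x (oexp x j) else oct1.

Definition is_oinv x y : Prop := omul x y = oct1 /\ omul y x = oct1.

(* The usual notion for algebras that need not be associative: left and right
   multiplications by nonzero elements are bijective. *)
Definition is_division : Prop :=
  forall x, x != 0 -> bijective (omul x) /\ bijective (omul^~ x).

(* A is alternative, so (h x) h^-1 = h (x h^-1). *)
Definition oconjugate x y : Prop :=
  exists h h', is_oinv h h' /\ omul (omul h x) h' = y.

End Octonions.

(** * Standard polynomials *)

Section Polynomials.
Variables (F : fieldType) (A : octonionAlgebra F).
Variables (n : nat) (c : 'I_n.+1 -> A).
Implicit Types (x z lambda : A) (N T : F).

Definition std_eval z : A := \sum_(i < n.+1) omul (c i) (oexp z i).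

Definition std_root z : Prop := std_eval z = 0.

Definition companion_coef (k : nat) : F :=
  \sum_(i < n.+1) \sum_(j < n.+1 | (i < j)%N && (i + j == k)%N)
     otr (omul (oconj (c i)) (c j))
  + (if odd k then 0 else onorm (c (inord k./2))).

Definition companion_eval z : A :=
  \sum_(k < n.*2.+1) companion_coef k *: oexp z k.

Definition companion_root z : Prop := companion_eval z = 0.

(* The leading coefficient c ord_max does not occur: it is meant to be 1. *)
Definition companion_mx : 'M[A]_n :=
  \matrix_(i, j) if i.+1 == j :> nat then oct1 A
                 else if i.+1 == n then - c (widen_ord (leqnSn n) j)
                 else 0.

Fixpoint epol N T (i : nat) : F :=
  if i is j.+1 then T * epol N T j + gpol N T j else 0
with gpol N T (i : nat) : F :=
  if i is j.+1 then - (N * epol N T j) else 1.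

Definition Epol N T : A := \sum_(i < n.+1) epol N T i *: c i.
Definition Gpol N T : A := \sum_(i < n.+1) gpol N T i *: c i.

End Polynomials.

(** * Left eigenvalues *)

Definition left_eigenvalue (F : fieldType) (A : octonionAlgebra F) (n : nat)
    (M : 'M[A]_n) (lambda : A) : Prop :=
  exists2 v : 'cV[A]_n, v != 0 &
    forall i, \sum_j omul (M i j) (v j ord0) = omul lambda (v i ord0).

(* Main.v *)
Require Import Defs.
From mathcomp Require Import all_boot all_order all_algebra all_field.
From mathcomp Require Import ring.

Set Implicit Arguments.
Unset Strict Implicit.
Unset Printing Implicit Defensive.

Import GRing.Theory.
Local Open Scope ring_scope.

(** Write N and T for the norm and the trace of z, and E, G for the values
    E(N,T), G(N,T).  If v is a left eigenvector for z with first entry g, the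
    rows of the companion matrix other than the last one force v to consist of
    the iterates g, z g, z (z g), ..., so g is nonzero, and the last row says
    that the sum of the c_i (z^i g) vanishes.  Left multiplication by z
    satisfies z (z g) = T (z g) - N g, so z is a left eigenvalue if and only if
      E (z g) + G g = 0   for some g <> 0        ([left_eigenvalueP]);
    g = 1 gives the roots of phi.  The same substitution in the companion
    polynomial, whose coefficients are the values on the c_i of the norm form
    and of its polar form <x, y>, gives ([companion_evalE])
      Phi(z) = (T Norm(E) + <E, G>) z + (Norm(G) - N Norm(E)).
    In a division algebra this is zero if and only if both coefficients are:
    if z is not a scalar this is linear independence, and if z = a is a scalar
    then Phi(a) = Norm(a E + G), so that G = - a E ([companion_rootP]).

    As the norm is multiplicative, E (z g) = - G g implies both
    Norm(G) = N Norm(E) and T Norm(E) = - <E, G> ([mul_eq0_norm_tr]), whence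
    left eigenvalues are roots of Phi.  Within a class of roots of Phi,
    E = 0 forces G = 0, so every element of the class is a left eigenvalue.
    If E <> 0, the equation E (z g) = - G g reads
    z = - (E^-1 (G g)) g^-1, which is the required form with gamma = G g, since
    gamma^-1 G = g^-1.  Conversely such a z solves the equation with
    g = G^-1 gamma, and [mul_eq0_norm_tr] shows that its norm and trace are
    those of the class, hence that it belongs to the class
    ([norm_tr_oconjugate]).  The case G = 0, where z = 0, is treated apart. *)

(** * The norm and the trace of the quaternion algebra *)

Section OctonionTheory.
Variables (F : fieldType) (A : octonionAlgebra F).
Local Notation Q := (oct_quat A).
Local Notation bar := (oct_bar A).
Local Notation l := (oct_ell2 A).
Implicit Types (p q r s : Q) (x y z : A) (k : F).

(** The reduced norm and trace of the quaternion p, as elements of F: the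
    coordinate along 1 of bar p * p and of p + bar p. *)
Definition qnorm p : F := oscal ((bar p * p, 0) : A).
Definition qtr p : F := oscal ((p + bar p, 0) : A).

Lemma barK p : bar (bar p) = p.
Proof. by case: (oct_barP A). Qed.

Lemma barM p q : bar (p * q) = bar q * bar p.
Proof. by case: (oct_barP A). Qed.

Lemma qtrE p : p + bar p = (qtr p)%:A.
Proof.
case: (oct_barP A) => _ _ trP _; have /vlineP[k Dk] := trP p.
suff ->: qtr p = k by [].
by rewrite /qtr Dk -[RHS](oscalK A) /oscal.
Qed.

Lemma qnormE p : bar p * p = (qnorm p)%:A.
Proof.
case: (oct_barP A) => _ _ _ nP; have /vlineP[k Dk] := nP p.
suff ->: qnorm p = k by [].
by rewrite /qnorm Dk -[RHS](oscalK A) /oscal.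
Qed.

Lemma scal_inj : injective (fun k => k%:A : Q).
Proof.
move=> k1 k2 e; rewrite -[k1](oscalK A) -[k2](oscalK A) /oscal /=.
by congr (coord _ _ _).
Qed.

Lemma barE p : bar p = (qtr p)%:A - p.
Proof. by rewrite -qtrE addrC addKr. Qed.

Lemma qnormEr p : p * bar p = (qnorm p)%:A.
Proof.
by rewrite -qnormE barE mulrBr mulrBl -scalerAr mulr1 -scalerAl mul1r.
Qed.

Lemma qnorm_bar p : qnorm (bar p) = qnorm p.
Proof. by apply: scal_inj; rewrite -qnormE barK qnormEr. Qed.

Lemma qnormM p q : qnorm (p * q) = qnorm p * qnorm q.
Proof.
apply: scal_inj; rewrite /= -qnormE barM mulrA -(mulrA (bar q)) qnormE.
by rewrite -scalerAr mulr1 -scalerAl qnormE scalerA.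
Qed.

Lemma qnormZ k p : qnorm (k *: p) = k ^+ 2 * qnorm p.
Proof.
apply: scal_inj; rewrite /= -qnormE linearZ /= -scalerAl -scalerAr qnormE.
by rewrite !scalerA expr2.
Qed.

Lemma qtrZ k p : qtr (k *: p) = k * qtr p.
Proof.
by apply: scal_inj; rewrite /= -qtrE linearZ /= -scalerDr qtrE scalerA.
Qed.

Lemma qnormD p q : qnorm (p + q) = qnorm p + qnorm q + qtr (bar p * q).
Proof.
apply: scal_inj; rewrite /= !scalerDl -!qnormE -qtrE barM barK linearD /=.
by rewrite mulrDl !mulrDr [bar q * p + _]addrC addrACA addrA.
Qed.

Lemma qtr_bar p : qtr (bar p) = qtr p.
Proof. by apply: scal_inj; rewrite /= -!qtrE barK addrC. Qed.

(** The two expressions bar p * p and p * bar p of the norm yield two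
    expressions of its polar form, whence the trace is symmetric. *)
Lemma qtrC p q : qtr (p * q) = qtr (q * p).
Proof.
have: qnorm (bar p + q) = qnorm (p + bar q).
  by rewrite -[RHS]qnorm_bar linearD /= barK.
rewrite !qnormD barK !qnorm_bar => /addrI ->.
by rewrite -barM qtr_bar.
Qed.

(** * Multiplication, norm and inverses in octonion algebras *)

Lemma onorm_pair p q : onorm ((p, q) : A) = qnorm p - l * qnorm q.
Proof.
rewrite -[RHS](oscalK A) /onorm /oscal /= mulrN scalerBl -qnormE -scalerA.
by rewrite -qnormE scalerN.
Qed.

Lemma onormZ k x : onorm (k *: x) = k ^+ 2 * onorm x.
Proof. by case: x => p q; rewrite !onorm_pair !qnormZ; ring. Qed.

Lemma onormM x y : onorm (omul x y) = onorm x * onorm y.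
Proof.
case: x y => p q [r s]; rewrite !onorm_pair /=.
rewrite !qnormD !qnormZ !qnormM !qnorm_bar -scalerAr qtrZ !barM.
rewrite -!mulrA (qtrC (bar r)) -!mulrA; ring.
Qed.

Lemma omulDl x y z : omul (x + y) z = omul x z + omul y z.
Proof.
case: x y z => p q [r s] [t u]; congr (_, _) => /=.
  by rewrite mulrDl mulrDr scalerDr addrACA.
by rewrite mulrDr mulrDl addrACA.
Qed.

Lemma omulDr x y z : omul z (x + y) = omul z x + omul z y.
Proof.
case: x y z => p q [r s] [t u]; congr (_, _) => /=.
  by rewrite linearD mulrDr mulrDl scalerDr addrACA.
by rewrite linearD mulrDr mulrDl addrACA.
Qed.

Lemma omulZl k x y : omul (k *: x) y = k *: omul x y.
Proof.
case: x y => p q [r s]; congr (_, _) => /=.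
  by rewrite -scalerAr -scalerAl !scalerDr !scalerA mulrC.
by rewrite -scalerAr -scalerAl scalerDr.
Qed.

Lemma omulZr k x y : omul x (k *: y) = k *: omul x y.
Proof.
case: x y => p q [r s]; congr (_, _) => /=.
  by rewrite linearZ -scalerAr -scalerAl !scalerDr !scalerA mulrC.
by rewrite linearZ -scalerAr -scalerAl scalerDr.
Qed.

Lemma omulNl x y : omul (- x) y = - omul x y.
Proof. by rewrite -scaleN1r omulZl scaleN1r. Qed.

Lemma omulNr x y : omul x (- y) = - omul x y.
Proof. by rewrite -scaleN1r omulZr scaleN1r. Qed.

Lemma omul0l x : omul 0 x = 0.
Proof. by have := omulZl 0 0 x; rewrite !scale0r. Qed.

Lemma omul0r x : omul x 0 = 0.
Proof. by have := omulZr 0 x 0; rewrite !scale0r. Qed.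

Lemma bar1 : bar 1 = 1.
Proof. by have := barM 1 (bar 1); rewrite mul1r barK mul1r. Qed.

Lemma omul1l x : omul (oct1 A) x = x.
Proof.
case: x => p q.
by congr (_, _); rewrite /= (mul1r, mul0r) ?mulr0 ?scaler0 ?mulr1 ?addr0.
Qed.

Lemma omul1r x : omul x (oct1 A) = x.
Proof.
case: x => p q; congr (_, _);
by rewrite /= ?linear0 ?bar1 ?mul0r ?mulr1 ?scaler0 ?addr0 ?add0r.
Qed.

(** The form of alternativity used throughout, with [omulK_oconj]. *)
Lemma oconj_mulK x y : omul (oconj x) (omul x y) = onorm x *: y.
Proof.
case: x y => p q [r s]; rewrite onorm_pair.
rewrite [LHS]surjective_pairing [RHS]surjective_pairing.
congr (_, _) => /=.
  rewrite linearD /= !barM barK mulrN mulrDl mulrDr -scalerAr !mulrA qnormE.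
  rewrite -(mulrA r) qnormE -scalerAr mulr1 -scalerAl mul1r.
  by rewrite scalerN scalerDr opprD addrA addrK scalerA scalerBl.
rewrite linearD linearZ /= !barM barK mulNr mulrDl mulrDr -!scalerAr.
rewrite -!mulrA qnormEr (mulrA q (bar q)) qnormEr -scalerAl mul1r.
by rewrite -scalerAr mulr1 opprD addrA addrK scalerA scalerBl.
Qed.

Lemma omulK_oconj x y : omul (omul y x) (oconj x) = onorm x *: y.
Proof.
case: x y => p q [r s]; rewrite onorm_pair.
rewrite [LHS]surjective_pairing [RHS]surjective_pairing.
congr (_, _) => /=.
  rewrite linearN /= mulNr mulrDl mulrDr -!scalerAl -!mulrA qnormEr.
  rewrite !mulrA qnormE -!scalerAr mulr1 -scalerAl mul1r.
  by rewrite scalerN scalerDr opprD addrACA subrr addr0 scalerA scalerBl.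
rewrite barK mulNr mulrDr !mulrDl.
rewrite !mulrA opprD addrACA addNr add0r -!mulrA qnormE -!scalerAr mulr1.
by rewrite mulrA qnormEr -scalerAl mul1r addrC scalerA scalerBl.
Qed.

(** The polar form of the norm; [onormD] is the polarization identity. *)
Definition opolar x y : F := otr (omul (oconj x) y).

Lemma otr_pair p q : otr ((p, q) : A) = qtr p.
Proof. by []. Qed.

Lemma otrD x y : otr (x + y) = otr x + otr y.
Proof.
apply: scal_inj; case: x y => p q [r s].
by rewrite /= scalerDl !otr_pair -!qtrE linearD /= addrACA.
Qed.

Lemma otrZ k x : otr (k *: x) = k * otr x.
Proof. by case: x => p q; rewrite !otr_pair qtrZ. Qed.

Lemma otr_conj x : otr (oconj x) = otr x.
Proof. by case: x => p q; rewrite !otr_pair qtr_bar. Qed.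

Lemma oconjK : involutive (@oconj F A).
Proof. by case=> p q; rewrite /oconj /= barK opprK. Qed.

Lemma oconjD x y : oconj (x + y) = oconj x + oconj y.
Proof.
by case: x y => p q [r s]; congr (_, _); rewrite /= (linearD, opprD).
Qed.

Lemma oconjZ k x : oconj (k *: x) = k *: oconj x.
Proof. by case: x => p q; congr (_, _); rewrite /= (linearZ, scalerN). Qed.

Lemma oconjE x : oconj x = otr x *: oct1 A - x.
Proof. by rewrite otrE addrC addKr. Qed.

Lemma onormD x y : onorm (x + y) = onorm x + onorm y + opolar x y.
Proof.
have -> : opolar x y = qtr (bar x.1 * y.1) - l * qtr (bar x.2 * y.2).
  case: x y => p q [r s]; rewrite /opolar otr_pair /=.
  apply: scal_inj; rewrite /= scalerBl -scalerA -!qtrE linearD linearZ /=.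
  rewrite mulrN linearN /= addrACA; congr (_ + _).
  by rewrite [bar (- _)]linearN /= scalerN -opprD -scalerDr !barM !barK addrC.
by case: x y => p q [r s]; rewrite !onorm_pair !qnormD; ring.
Qed.

Lemma opolarE x y : opolar x y = onorm (x + y) - onorm x - onorm y.
Proof. by rewrite onormD; ring. Qed.

Lemma opolarC x y : opolar x y = opolar y x.
Proof. by rewrite !opolarE (addrC y); ring. Qed.

Lemma opolarDl x y z : opolar (x + y) z = opolar x z + opolar y z.
Proof. by rewrite /opolar oconjD omulDl otrD. Qed.

Lemma opolarDr x y z : opolar z (x + y) = opolar z x + opolar z y.
Proof. by rewrite /opolar omulDr otrD. Qed.

Lemma opolarZl k x y : opolar (k *: x) y = k * opolar x y.
Proof. by rewrite /opolar oconjZ omulZl otrZ. Qed.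

Lemma opolarZr k x y : opolar x (k *: y) = k * opolar x y.
Proof. by rewrite /opolar omulZr otrZ. Qed.

Lemma opolarxx x : opolar x x = 2%:R * onorm x.
Proof.
by rewrite opolarE -{1 2}[x]scale1r -scalerDl onormZ; ring.
Qed.

Lemma opolar1 x : opolar x (oct1 A) = otr x.
Proof. by rewrite /opolar omul1r otr_conj. Qed.

Lemma opolarMr x y z : opolar (omul x z) (omul y z) = opolar x y * onorm z.
Proof. by rewrite !opolarE -omulDl !onormM; ring. Qed.

Lemma opolarMl x y z : opolar (omul z x) (omul z y) = onorm z * opolar x y.
Proof. by rewrite !opolarE -omulDr !onormM; ring. Qed.

Lemma onorm0 : onorm (0 : A) = 0.
Proof. by have := onormZ 0 0; rewrite scale0r expr0n mul0r. Qed.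

Lemma onormN x : onorm (- x) = onorm x.
Proof. by rewrite -scaleN1r onormZ; ring. Qed.

Lemma onorm1 : onorm (oct1 A) = 1.
Proof.
rewrite /onorm omul1r -[RHS](oscalK A) scale1r; congr oscal.
by congr (_, _); rewrite /= ?bar1 ?oppr0.
Qed.

Lemma omul_mul x y : omul x (omul x y) = otr x *: omul x y - onorm x *: y.
Proof.
by rewrite -oconj_mulK oconjE omulDl omulNl omulZl omul1l opprB addrC subrK.
Qed.

Lemma oinv_norm x y : is_oinv x y -> onorm x * onorm y = 1.
Proof. by case=> xy _; rewrite -onormM xy onorm1. Qed.

Lemma oinv_norm_neq0 x y : is_oinv x y -> onorm x != 0.
Proof.
by move/oinv_norm; apply: contra_eqN => /eqP->; rewrite mul0r eq_sym oner_eq0.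
Qed.

Lemma oinv_neq0 x y : is_oinv x y -> x != 0.
Proof. by move/oinv_norm_neq0; apply: contraNneq => ->; rewrite onorm0. Qed.

Lemma oinv_sym x y : is_oinv x y -> is_oinv y x.
Proof. by case. Qed.

Lemma oinvE x y : is_oinv x y -> y = (onorm x)^-1 *: oconj x.
Proof.
move=> xy; have nx0 := oinv_norm_neq0 xy; case: xy => xy _.
by rewrite -[oconj x]omul1r -xy oconj_mulK scalerA mulVf ?scale1r.
Qed.

Lemma oinv_of_norm x : onorm x != 0 -> is_oinv x ((onorm x)^-1 *: oconj x).
Proof.
move=> nx0; split.
  rewrite omulZr -[x in omul x _]omul1l omulK_oconj scalerA mulVf ?scale1r//.
by rewrite omulZl -[x in omul _ x]omul1r oconj_mulK scalerA mulVf ?scale1r.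
Qed.

Lemma oinv_mulKl x y z : is_oinv x y -> omul y (omul x z) = z.
Proof.
move=> xy; have nx0 := oinv_norm_neq0 xy.
by rewrite (oinvE xy) omulZl oconj_mulK scalerA mulVf ?scale1r.
Qed.

Lemma oinv_mulKr x y z : is_oinv x y -> omul (omul z x) y = z.
Proof.
move=> xy; have nx0 := oinv_norm_neq0 xy.
by rewrite (oinvE xy) omulZr omulK_oconj scalerA mulVf ?scale1r.
Qed.

(** If invertible, such an h conjugates x to oconj x.  It is found in Q ell: as
    s ranges over Q, the products s ell satisfy the equation exactly when a
    linear form vanishes at s, and dim Q > 1. *)
Lemma exists_skew_commuting x :
  exists2 h : A, h != 0 & omul h x = omul (oconj x) h.
Proof.
case: x => p q.
have [s s0 ts]: exists2 s, s != 0 & qtr (bar q * s) = 0.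
  have qtD a b : qtr (a + b) = qtr a + qtr b by apply: (otrD (a, 0) (b, 0)).
  (* s is a zero of the linear form s |-> qtr (bar q * s) in the span of 1 and
     of a nonscalar v. *)
  have [t1|t1] := eqVneq (qtr (bar q)) 0.
    by exists 1; rewrite ?oner_eq0 // mulr1.
  have [v v1]: exists v : Q, v \notin 1%VS.
    have /subvPn[v _ v1]: ~~ ({:Q} <= 1)%VS.
      apply/negP => /dimvS; case: (oct_quatP A) => -> _ _.
      by rewrite dimv1.
    by exists v.
  exists (qtr (bar q * v) *: 1 - qtr (bar q) *: v).
    rewrite subr_eq0; apply: contraNneq v1 => e.
    apply/vlineP; exists ((qtr (bar q))^-1 * qtr (bar q * v)).
    by rewrite -scalerA e scalerA mulVf ?scale1r.
  by rewrite mulrBr -!scalerAr mulr1 qtD -scaleN1r !qtrZ; ring.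
exists (0, s); first by rewrite xpair_eqE negb_and s0 orbT.
congr (_, _); rewrite /=.
  rewrite mul0r mulr0 !add0r mulrN; apply/eqP.
  rewrite -subr_eq0 scalerN opprK -scalerDr.
  have -> : bar s * q = bar (bar q * s) by rewrite barM barK.
  by rewrite qtrE ts scale0r scaler0.
by rewrite linear0 !mulr0 addr0 add0r.
Qed.

(** * Conjugacy classes *)

Lemma oconjugate_norm_tr x y :
  oconjugate x y -> onorm y = onorm x /\ otr y = otr x.
Proof.
case=> h [h' [hh' Dy]]; have nh0 := oinv_norm_neq0 hh'.
have yh : omul y h = omul h x.
  by rewrite -Dy; apply: oinv_mulKr (oinv_sym hh').
split; apply: (mulIf nh0); first by rewrite -onormM yh onormM mulrC.
rewrite -!opolar1 -opolarMr yh mulrC -opolarMl.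
by rewrite omul1l omul1r.
Qed.

(** If x (z g) = - y g with g invertible, then the norm and the trace of z are
    determined by x and y as soon as the norm of x is nonzero. *)
Lemma mul_eq0_norm_tr x y z g : onorm g != 0 ->
  omul x (omul z g) + omul y g = 0 ->
  otr z * onorm x + opolar x y = 0 /\ onorm y = onorm z * onorm x.
Proof.
move=> ng0 /eqP; rewrite addr_eq0 => /eqP xzg; split; apply: (mulIf ng0).
  have pg : opolar g (omul z g) = otr z * onorm g.
    by rewrite opolarC -{2}[g]omul1l opolarMr opolar1.
  rewrite mulrDl -opolarMr -[omul y g]opprK -xzg -scaleN1r opolarZr opolarMl pg.
  ring.
by rewrite -(onormM y) -(onormN (omul y g)) -xzg !onormM; ring.
Qed.

Hypothesis hA : is_division A.

Lemma onorm_eq0 x : (onorm x == 0) = (x == 0).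
Proof.
apply/eqP/eqP => [nx|->]; last exact: onorm0.
apply/eqP/negPn/negP => x0; have [_ /bij_inj inj] := hA x0.
have xc0 : oconj x = 0.
  by apply: inj; rewrite omul0l -onormE nx scale0r.
by case/eqP: x0; rewrite -[x]oconjK xc0 -(scale0r 0) oconjZ !scale0r.
Qed.

Lemma exists_oinv x : x != 0 -> exists y, is_oinv x y.
Proof.
by rewrite -onorm_eq0 => /oinv_of_norm; exists ((onorm x)^-1 *: oconj x).
Qed.

(** Conjugacy classes are determined by norm and trace.  The element
    h = y - oconj x satisfies h x = y h when x and y have the same norm and
    trace; the case h = 0 is [exists_skew_commuting]. *)
Lemma norm_tr_oconjugate x y :
  onorm x = onorm y -> otr x = otr y -> oconjugate x y.
Proof.
move=> nxy txy.
have [h h0 Dh]: exists2 h, h != 0 & omul h x = omul y h.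
  have [->|yx] := eqVneq y (oconj x); first exact: exists_skew_commuting.
  exists (y - oconj x); first by rewrite subr_eq0.
  rewrite omulDl omulDr omulNl omulNr -onormE.
  apply/eqP; rewrite -subr_eq0 oconjE omulDr omulZr omul1r omulNr.
  have := omul_mul y (oct1 A); rewrite !omul1r => ->.
  rewrite nxy txy.
  by rewrite [- (_ - omul y x)]opprB [X in _ - X]addrC subrKA subrr.
have [h' hh'] := exists_oinv h0.
(* Then (h x) h' = (y h) h' = y by alternativity. *)
by exists h, h'; split=> //; rewrite Dh; apply: oinv_mulKr hh'.
Qed.

End OctonionTheory.

(** * Norms of sums *)

Local Arguments omul : simpl never.

Section NormsOfSums.
Variables (F : fieldType) (A : octonionAlgebra F).
Implicit Types (x y z : A).

Lemma opolar_suml n (x : 'I_n -> A) y :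
  opolar (\sum_i x i) y = \sum_i opolar (x i) y.
Proof.
elim/big_rec2: _ => [|i s t _ <-]; last by rewrite opolarDl.
by have := opolarZl 0 0 y; rewrite scale0r mul0r.
Qed.

(** The diagonal is kept apart, as 2 need not be invertible. *)
Lemma onorm_sum n (x : 'I_n -> A) :
  onorm (\sum_i x i) =
  \sum_(i < n) \sum_(j < n | (i < j)%N) opolar (x i) (x j) + \sum_i onorm (x i).
Proof.
elim: n x => [|n IHn] x; first by rewrite !big_ord0 onorm0 addr0.
have -> : \sum_(i < n.+1) \sum_(j < n.+1 | (i < j)%N) opolar (x i) (x j) =
    \sum_(i < n) \sum_(j < n | (i < j)%N)
       opolar (x (widen_ord (leqnSn n) i)) (x (widen_ord (leqnSn n) j))
    + \sum_(i < n) opolar (x (widen_ord (leqnSn n) i)) (x ord_max).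
  rewrite big_ord_recr /= [X in _ + X]big_pred0 => [|j]; last first.
    by rewrite ltnNge -ltnS ltn_ord.
  rewrite addr0 -big_split; apply: eq_bigr => i _ /=.
  by rewrite big_mkcond big_ord_recr /= ltn_ord -big_mkcond.
by rewrite !big_ord_recr /= onormD IHn opolar_suml; ring.
Qed.

Lemma opolar_sum n (x y : 'I_n -> A) :
  opolar (\sum_i x i) (\sum_i y i) =
  \sum_(i < n) \sum_(j < n | (i < j)%N)
     (opolar (x i) (y j) + opolar (y i) (x j)) + \sum_i opolar (x i) (y i).
Proof.
rewrite opolarE -big_split /= !onorm_sum.
rewrite opprD addrACA -!sumrB opprD addrACA -!sumrB.
congr (_ + _); apply: eq_bigr => i _; last by rewrite onormD; ring.
by rewrite -!sumrB; apply: eq_bigr => j _; rewrite opolarDl !opolarDr; ring.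
Qed.

Lemma omul_suml n (x : 'I_n -> A) y :
  omul (\sum_i x i) y = \sum_i omul (x i) y.
Proof.
elim/big_rec2: _ => [|i s t _ <-]; last by rewrite omulDl.
by rewrite omul0l.
Qed.

End NormsOfSums.

(** * Standard polynomials and companion polynomials *)

Section StandardPolynomials.
Variables (F : fieldType) (A : octonionAlgebra F).
Variables (n : nat) (c : 'I_n.+1 -> A).
Implicit Types (x z g : A) (N T : F).

(** Multiplication in F[z] / (z^2 - T z + N), in the basis z, 1. *)
Lemma epol_gpolD N T i j :
  epol N T (i + j) = T * epol N T i * epol N T j + epol N T i * gpol N T j
                     + gpol N T i * epol N T j
  /\ gpol N T (i + j) = gpol N T i * gpol N T j - N * (epol N T i * epol N T j).
Proof.
elim: i => [|i [IHe IHg]]; first by rewrite add0n /=; split; ring.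
by rewrite addSn /= IHe IHg; split; ring.
Qed.

(** The iterate z (z (... (z g))) with i factors z, in closed form; see [opow0]
    and [opowS]. *)
Definition opow z g i : A :=
  epol (onorm z) (otr z) i *: omul z g + gpol (onorm z) (otr z) i *: g.

Lemma opow0 z g : opow z g 0 = g.
Proof. by rewrite /opow /= scale0r add0r scale1r. Qed.

Lemma opowS z g i : opow z g i.+1 = omul z (opow z g i).
Proof.
rewrite /opow /= omulDr !omulZr omul_mul scalerBr !scalerA scalerDl.
by rewrite addrAC scaleNr mulrC (mulrC (onorm z)).
Qed.

Lemma oexpE z i : oexp z i = opow z (oct1 A) i.
Proof. by elim: i => [|i IHi]; rewrite (opow0, opowS) //= IHi. Qed.

Lemma sum_mul_opow z g :
  \sum_(i < n.+1) omul (c i) (opow z g i) =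
  omul (Epol c (onorm z) (otr z)) (omul z g)
  + omul (Gpol c (onorm z) (otr z)) g.
Proof.
rewrite !omul_suml -big_split /=; apply: eq_bigr => i _.
by rewrite omulDr !omulZr !omulZl.
Qed.

Lemma companion_coef_sum (f : nat -> F) :
  \sum_(k < n.*2.+1) companion_coef c k * f k =
  \sum_(i < n.+1) \sum_(j < n.+1 | (i < j)%N) opolar (c i) (c j) * f (i + j)%N
  + \sum_i onorm (c i) * f i.*2.
Proof.
under eq_bigr do rewrite mulrDl.
rewrite big_split /=; congr (_ + _).
  under eq_bigr do rewrite mulr_suml.
  rewrite exchange_big /=; apply: eq_bigr => i _.
  under eq_bigr do rewrite mulr_suml.
  rewrite (exchange_big_dep (fun j : 'I_n.+1 => (i < j)%N)) /=; last first.
    by move=> k j _ /andP[].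
  apply: eq_bigr => j ij.
  have ijn : (i + j < n.*2.+1)%N.
    by rewrite ltnS -addnn leq_add // -ltnS.
  by rewrite (big_pred1 (Ordinal ijn)) // => k; rewrite ij eq_sym.
have sum_even (h : nat -> F) m :
    \sum_(k < m.*2.+1) (if odd k then 0 else h k./2) * f k =
    \sum_(i < m.+1) h i * f i.*2.
  elim: m => [|m IHm]; first by rewrite !big_ord_recr !big_ord0.
  rewrite doubleS 2!big_ord_recr IHm /= [RHS]big_ord_recr /= odd_double /=.
  by rewrite mul0r addr0 doubleK.
rewrite (sum_even (fun i => onorm (c (inord i)))).
by apply: eq_bigr => i _; rewrite inord_val.
Qed.

Lemma companion_evalE z :
  let N := onorm z in let T := otr z in
  let E := Epol c N T in let G := Gpol c N T in
  companion_eval c z =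
    (T * onorm E + opolar E G) *: z + (onorm G - N * onorm E) *: oct1 A.
Proof.
move=> N T E G.
have -> : companion_eval c z =
    (\sum_(k < n.*2.+1) companion_coef c k * epol N T k) *: z
    + (\sum_(k < n.*2.+1) companion_coef c k * gpol N T k) *: oct1 A.
  rewrite !scaler_suml -big_split; apply: eq_bigr => k _ /=.
  by rewrite oexpE /opow omul1r scalerDr !scalerA.
rewrite !companion_coef_sum !onorm_sum opolar_sum.
congr (_ *: z + _ *: oct1 A).
  rewrite mulrDr addrACA; congr (_ + _); rewrite mulr_sumr -big_split /=.
    apply: eq_bigr => i _; rewrite mulr_sumr -big_split.
    apply: eq_bigr => j _ /=.
    rewrite !(opolarZl, opolarZr); have [-> _] := epol_gpolD N T i j; ring.
  apply: eq_bigr => i _; rewrite !(opolarZl, opolarZr) opolarxx onormZ -addnn.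
  have [-> _] := epol_gpolD N T i i; ring.
rewrite mulrDr opprD addrACA; congr (_ + _); rewrite mulr_sumr -sumrB.
  apply: eq_bigr => i _; rewrite mulr_sumr -sumrB; apply: eq_bigr => j _ /=.
  rewrite !(opolarZl, opolarZr); have [_ ->] := epol_gpolD N T i j; ring.
apply: eq_bigr => i _; rewrite !onormZ -addnn.
have [_ ->] := epol_gpolD N T i i; ring.
Qed.

Lemma companion_rootP (hA : is_division A) z :
  let N := onorm z in let T := otr z in
  let E := Epol c N T in let G := Gpol c N T in
  companion_root c z <->
  T * onorm E + opolar E G = 0 /\ onorm G = N * onorm E.
Proof.
move=> N T E G; rewrite /companion_root companion_evalE -/N -/T -/E -/G.
set X := _ + opolar E G; set Y := _ - _.
split=> [XY0|[-> DG]]; last by rewrite /Y DG subrr !scale0r addr0.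
suff X0 : X = 0.
  split=> //; apply/eqP; rewrite -subr_eq0 -/Y; apply/eqP.
  move: XY0; rewrite X0 scale0r add0r => Y0.
  by rewrite -(oscalK A Y) Y0 -(scale0r (oct1 A)) oscalK.
apply/eqP/negPn/negP => X0.
(* Otherwise z is a scalar a. *)
pose a := - (X^-1 * Y).
have Dz : z = a *: oct1 A.
  apply: (scalerI X0); apply/eqP; rewrite -subr_eq0 scalerA mulrN mulVKf //.
  by rewrite scaleNr opprK XY0.
have DN : N = a ^+ 2 by rewrite /N Dz onormZ onorm1 mulr1.
have DT : T = 2%:R * a by rewrite /T Dz otrZ -opolar1 opolarxx onorm1; ring.
have XaY : X * a = - Y by rewrite /a mulrN mulVKf.
(* This norm is Phi(a). *)
have : onorm (a *: E + G) = 0.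
  rewrite onormD onormZ opolarZl.
  have -> : a ^+ 2 * onorm E + onorm G + a * opolar E G = X * a + Y.
    by rewrite /X /Y DT DN; ring.
  by rewrite XaY addNr.
move/eqP; rewrite onorm_eq0 // addrC addr_eq0 => /eqP DG.
case/eqP: X0; rewrite /X DG -scaleN1r !opolarZr opolarxx DT; ring.
Qed.

(** * Left eigenvalues of the companion matrix *)

Lemma left_eigenvalueP z : (1 <= n)%N -> c ord_max = oct1 A ->
  left_eigenvalue (companion_mx c) z <->
  exists2 g, g != 0 &
    omul (Epol c (onorm z) (otr z)) (omul z g)
    + omul (Gpol c (onorm z) (otr z)) g = 0.
Proof.
move=> n_gt0 c1.
have row_last (v : 'cV[A]_n) (i : 'I_n) : i.+1 = n ->
  \sum_j omul (companion_mx c i j) (v j ord0)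
  = - \sum_j omul (c (widen_ord (leqnSn n) j)) (v j ord0).
  move=> Di; rewrite -sumrN; apply: eq_bigr => j _; rewrite mxE Di eqxx.
  by rewrite gtn_eqF // omulNl.
have row_next (v : 'cV[A]_n) (i j : 'I_n) : i.+1 = j ->
  \sum_j omul (companion_mx c i j) (v j ord0) = v j ord0.
  move=> Dj; rewrite (bigD1 j) //= mxE Dj eqxx omul1l big1 ?addr0 // => k kj.
  by rewrite mxE Dj eq_sym (val_eqE k j) (negPf kj) ltn_eqF // omul0l.
have sum_last g : \sum_(i < n.+1) omul (c i) (opow z g i)
  = opow z g n + \sum_(j < n) omul (c (widen_ord (leqnSn n) j)) (opow z g j).
  by rewrite big_ord_recr /= c1 omul1l addrC.
split=> [[v v0 Cv] | [g g0 Eg]].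
  pose i0 := Ordinal n_gt0.
  have Dv (i : 'I_n) : v i ord0 = opow z (v i0 ord0) i.
    case: i => i; elim: i => [|i IHi] lt_in.
      by rewrite opow0; congr (v _ _); apply: val_inj.
    rewrite opowS -(IHi (ltnW lt_in)) -Cv.
    by rewrite (row_next v _ (Ordinal lt_in)).
  exists (v i0 ord0).
    apply: contraNneq v0 => g0; apply/eqP/matrixP=> i j.
    by rewrite ord1 Dv g0 mxE /opow omul0r !scaler0 addr0.
  have ltn : (n.-1 < n)%N by rewrite prednK.
  have := Cv (Ordinal ltn); rewrite row_last /= ?prednK // Dv /= -opowS.
  rewrite prednK // => Dn; rewrite -sum_mul_opow sum_last -Dn.
  by rewrite (eq_bigr _ (fun i _ => congr1 (omul _) (Dv i))) addNr.
exists (\col_i opow z g i).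
  apply: contraNneq g0 => /colP/(_ (Ordinal n_gt0)).
  by rewrite !mxE opow0 => ->.
move=> i; rewrite mxE -opowS.
have:= ltn_ord i; rewrite leq_eqVlt => /orP[/eqP Di | lt_in].
  rewrite row_last // Di; apply/eqP; rewrite eq_sym -subr_eq0 opprK.
  under eq_bigr do rewrite mxE.
  by rewrite -sum_last sum_mul_opow Eg.
by rewrite (row_next _ _ (Ordinal lt_in)) // mxE.
Qed.

End StandardPolynomials.

Theorem theorem4p2 (F : fieldType) (A : octonionAlgebra F)
    (hA : is_division A) (n : nat) (hn : (1 <= n)%N)
    (c : 'I_n.+1 -> A) (hc : c ord_max = oct1 A) :
  [/\ forall z : A, std_root c z -> left_eigenvalue (companion_mx c) z,
      forall z : A, left_eigenvalue (companion_mx c) z -> companion_root c z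
    & forall z0 : A,
        (forall z : A, oconjugate z0 z -> companion_root c z) ->
        let E := Epol c (onorm z0) (otr z0) in
        let G := Gpol c (onorm z0) (otr z0) in
        (E = 0 ->
           forall z : A, oconjugate z0 z ->
             left_eigenvalue (companion_mx c) z)
        /\ (E <> 0 ->
           exists2 E' : A, is_oinv E E' &
             forall z : A,
               (oconjugate z0 z /\ left_eigenvalue (companion_mx c) z) <->
               (exists gamma gamma' : A, is_oinv gamma gamma' /\
                  z = - omul (omul E' gamma) (omul gamma' G)))].
Proof.
have one0 : oct1 A != 0 by rewrite -onorm_eq0 // onorm1 oner_eq0.
have one_inv : is_oinv (oct1 A) (oct1 A) by split; rewrite omul1l.
split=> [z z_root | z /(left_eigenvalueP _ hn hc)[g g0 Eg] | z0 class_root E G].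
- apply/(left_eigenvalueP _ hn hc); exists (oct1 A) => //.
  rewrite -sum_mul_opow -[RHS]z_root; apply: eq_bigr => i _.
  by rewrite oexpE.
- apply/(companion_rootP _ hA); apply: (mul_eq0_norm_tr _ Eg).
  by rewrite onorm_eq0.
have /(companion_rootP _ hA) : companion_root c z0.
  by apply: class_root; apply: norm_tr_oconjugate.
rewrite -/E -/G => -[trE normG].
have class_eigP z : oconjugate z0 z -> left_eigenvalue (companion_mx c) z <->
    exists2 g, g != 0 & omul E (omul z g) + omul G g = 0.
  by case/oconjugate_norm_tr => Nz Tz; rewrite (left_eigenvalueP _ hn hc) Nz Tz.
split=> [E0 z z0z | /eqP E0].
  apply/(class_eigP z z0z); exists (oct1 A) => //.
  have /eqP : onorm G = 0 by rewrite normG E0 onorm0 mulr0.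
  by rewrite onorm_eq0 // => /eqP->; rewrite E0 !omul0l addr0.
have [E' EE'] := exists_oinv hA E0; exists E' => // z; split.
  case=> z0z /(class_eigP z z0z)[g g0 /eqP]; rewrite addr_eq0 => /eqP Eg.
  have Dzg : omul z g = - omul E' (omul G g).
    by rewrite -[LHS](oinv_mulKl _ EE') Eg omulNr.
  have [g' gg'] := exists_oinv hA g0.
  have [G0|G0] := eqVneq G 0.
    exists (oct1 A), (oct1 A); split=> //.
    rewrite -[LHS](oinv_mulKr _ gg') Dzg G0.
    by rewrite omul1l omul0l !omul0r oppr0 omul0l.
  have Gg0 : omul G g != 0 by rewrite -onorm_eq0 // onormM mulf_neq0 ?onorm_eq0.
  have [d dd'] := exists_oinv hA Gg0.
  exists (omul G g), d; split=> //.
  (* G = (G g) g', and d is the inverse of G g. *)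
  have -> : omul d G = g'.
    by rewrite -{1}[G](oinv_mulKr _ gg') (oinv_mulKl _ dd').
  by rewrite -[LHS](oinv_mulKr _ gg') Dzg omulNl.
case=> g [g' [gg' Dz]].
have [G0|G0] := eqVneq G 0.
  have Dz0 : z = 0 by rewrite Dz G0 !omul0r oppr0.
  have /eqP : onorm z0 = 0.
    apply/eqP; move: normG => /esym/eqP; rewrite G0 onorm0 mulf_eq0.
    by rewrite (onorm_eq0 hA E) (negPf E0) orbF.
  rewrite onorm_eq0 // => /eqP z00.
  have z0z : oconjugate z0 z by rewrite Dz0 z00; apply: norm_tr_oconjugate.
  split=> //; apply/(class_eigP z z0z); exists (oct1 A) => //.
  by rewrite G0 Dz0 !omul0l omul0r addr0.
have [G' GG'] := exists_oinv hA G0.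
pose d := omul G' g.
have Gd : omul G d = g by apply: oinv_mulKl (oinv_sym GG').
have g0 : g != 0 := oinv_neq0 gg'.
have d0 : d != 0.
  by apply: contraNneq g0 => d0; rewrite -Gd d0 omul0r.
(* If w is the inverse of d, then G = (G d) w = g w, so w = g' G. *)
have dinv : is_oinv d (omul g' G).
  have [w dw] := exists_oinv hA d0; suff -> : omul g' G = w by [].
  by rewrite -{1}[G](oinv_mulKr _ dw) Gd (oinv_mulKl _ gg').
have Ezd : omul E (omul z d) + omul G d = 0.
  rewrite Dz omulNl omulNr (oinv_mulKr _ (oinv_sym dinv)).
  by rewrite (oinv_mulKl _ (oinv_sym EE')) Gd addNr.
have z0z : oconjugate z0 z.
  have nE0 : onorm E != 0 by rewrite onorm_eq0.
  have [|trz normz] := mul_eq0_norm_tr _ Ezd; first by rewrite onorm_eq0.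
  apply: (norm_tr_oconjugate hA); apply: (mulIf nE0).
    by rewrite -normG normz.
  by apply: (addIr (opolar E G)); rewrite trE trz.
by split=> //; apply/(class_eigP z z0z); exists d.
Qed.
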